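(* Let $\gamma>0$, $\rho>0$ and assume that $\mathrm{Ker}(\mathcal{A})$ satisfies the deep-Null Space Property with respect to the collection of models $\mathcal{M}$ with constants $(\gamma,\rho)$. Let $X\in\mathbb{R}^{m\times n}$, $\overline{L},L^*\in\mathbb{N}$, $\overline{\mathbf{h}}\in\mathcal{M}^{\overline L}$, $\mathbf{h}^*\in\mathcal{M}^{L^*}$ and $\delta,\eta\geq0$ be such that $$\|M_1(\overline{\mathbf{h}}_1)\cdots M_K(\overline{\mathbf{h}}_K)-X\|\leq\delta,\qquad \|M_1(\mathbf{h}^*_1)\cdots M_K(\mathbf{h}^*_K)-X\|\leq\eta,$$ and $\delta+\eta\leq\rho$. Then $$\|P(\mathbf{h}^* )-P(\overline{\mathbf{h}})\|\leq\frac{\gamma}{\sigma_{min}}(\delta+\eta),$$ where $\sigma_{min}$ is the smallest non-zero singular value of $\mathcal{A}$. Moreover, if $\overline{\mathbf{h}}\in\mathbb{R}^{S\times K}_*$ and $\frac{\gamma}{\sigma_{min}}(\delta+\eta)\leq\frac12\max\left(\|P(\overline{\mathbf{h}})\|_\infty,\|P(\mathbf{h}^* )\|_\infty\right)$, then for every $p\in[1,\infty]$ $$d_p(\langle\mathbf{h}^*\rangle,\langle\overline{\mathbf{h}}\rangle)\leq\frac{7(KS)^{\frac1p}\gamma}{\sigma_{min}}\min\left(\|P(\overline{\mathbf{h}})\|_\infty^{\frac1K-1},\|P(\mathbf{h}^* )\|_\infty^{\frac1K-1}\right)(\delta+\eta).$$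
   Context: $K\geq 1$, $S\geq 2$ are integers, $[K]=\{1,\dots,K\}$, $[S]=\{1,\dots,S\}$. An element $\mathbf{h}\in\mathbb{R}^{S\times K}$ is a $K$-tuple of vectors $\mathbf{h}_1,\dots,\mathbf{h}_K\in\mathbb{R}^S$ with entries $\mathbf{h}_{k,i}$. $\mathbb{R}^{S^K}$ is the space of real order-$K$ tensors. $\|\cdot\|$ is the Euclidean (Frobenius) norm and $\|\cdot\|_p$ the entrywise $\ell^p$ norm (max of absolute values if $p=\infty$; $1/\infty=0$). $P:\mathbb{R}^{S\times K}\to\mathbb{R}^{S^K}$, $P(\mathbf{h})_{\mathbf{i}}=\mathbf{h}_{1,i_1}\cdots\mathbf{h}_{K,i_K}$ for $\mathbf{i}\in[S]^K$. $M_k:\mathbb{R}^S\to\mathbb{R}^{m_k\times m_{k+1}}$ ($k=1,\dots,K$, $m_1=m$, $m_{K+1}=n$) are linear maps and $\mathcal{A}:\mathbb{R}^{S^K}\to\mathbb{R}^{m\times n}$ is the unique linear map such that $M_1(\mathbf{h}_1)\cdots M_K(\mathbf{h}_K)=\mathcal{A}P(\mathbf{h})$ for all $\mathbf{h}$; $\mathcal{A}\neq0$. $\mathcal{M}=(\mathcal{M}^L)_{L\in\mathbb{N}}$ is a collection of models: each $\mathcal{M}^L$ is a nonempty subset of $\mathbb{R}^{S\times K}$. $P(\mathcal{M}^L)-P(\mathcal{M}^{L'})=\{P(\mathbf{h})-P(\mathbf{g}) : \mathbf{h}\in\mathcal{M}^L,\ \mathbf{g}\in\mathcal{M}^{L'}\}$.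 Deep-Null Space Property: $\mathrm{Ker}(\mathcal{A})$ satisfies it with respect to $\mathcal{M}$ with constants $(\gamma,\rho)$ if for all $L,L'\in\mathbb{N}$, every $T\in P(\mathcal{M}^L)-P(\mathcal{M}^{L'})$ with $\|\mathcal{A}T\|\leq\rho$ and every $T'\in\mathrm{Ker}(\mathcal{A})$, one has $\|T\|\leq\gamma\|T-T'\|$. $\mathbb{R}^{S\times K}_*=\{\mathbf{h} : \mathbf{h}_k\neq0\ \forall k\in[K]\}$; on it, $\mathbf{h}\sim\mathbf{g}$ iff there are $\lambda_1,\dots,\lambda_K\in\mathbb{R}$ with $\prod_k\lambda_k=1$ and $\mathbf{h}_k=\lambda_k\mathbf{g}_k$ for all $k$; $\langle\mathbf{h}\rangle$ is the class of $\mathbf{h}$. $\mathbb{R}^{S\times K}_{\rm diag}=\{\mathbf{h}\in\mathbb{R}^{S\times K}_* : \|\mathbf{h}_k\|_\infty=\|\mathbf{h}_1\|_\infty\ \forall k\in[K]\}$ and, for $\mathbf{h},\mathbf{g}\in\mathbb{R}^{S\times K}_*$, $d_p(\langle\mathbf{h}\rangle,\langle\mathbf{g}\rangle)=\inf\{\|\mathbf{h}'-\mathbf{g}'\|_p : \mathbf{h}'\in\langle\mathbf{h}\rangle\cap\mathbb{R}^{S\times K}_{\rm diag},\ \mathbf{g}'\in\langle\mathbf{g}\rangle\cap\mathbb{R}^{S\times K}_{\rm diag}\}$. (Under the hypotheses of the last assertion $\mathbf{h}^*$ also lies in $\mathbb{R}^{S\times K}_*$, so the left-hand side is defined.) *)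

(* Defs.v *)
From HB Require Import structures.
From mathcomp Require Import all_boot all_order all_algebra.
From mathcomp Require Import all_classical all_reals.
From mathcomp Require Import ereal exp.

Set Implicit Arguments.
Unset Strict Implicit.
Unset Printing Implicit Defensive.

Import Order.TTheory GRing.Theory Num.Theory.

Local Open Scope classical_set_scope.
Local Open Scope ring_scope.

(* [R^o] is the type carrying the [R]-module structure of the scalars. *)
Notation tensor R S K := {ffun {ffun 'I_K -> 'I_S} -> R^o}.

Section Norms.
Variables (R : realType) (I : finType).
Implicit Types f : I -> R.

Definition l2norm f : R := Num.sqrt (\sum_i f i ^+ 2).

Definition linfnorm f : R := \big[Num.max/0]_i `|f i|.

(* Only meant for [1 <= p]; the value at [-oo] is junk. *)
Definition lpnorm (p : \bar R) f : R :=
  match p with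
  | r%:E => (\sum_i `|f i| `^ r) `^ r^-1
  | +oo%E => linfnorm f
  | -oo%E => 0
  end.

End Norms.

(* [1/p], with [1/oo = 0]. *)
Definition exponent_inv (R : realType) (p : \bar R) : R :=
  if p is r%:E then r^-1 else 0.

(* The family of all entries of a matrix: the norms above become entrywise. *)
Definition mxentries (R : realType) (m n : nat) (X : 'M[R]_(m, n))
  (ij : 'I_m * 'I_n) : R := X ij.1 ij.2.

Section Factors.
Variables (R : realType) (S K : nat).
Implicit Types h g : 'M[R]_(S, K).

(* The vector [h_k] of the text is [col k h], and [h_{k,i}] is [h i k]. *)
Definition segre h : tensor R S K :=
  [ffun i : {ffun 'I_K -> 'I_S} => \prod_(k < K) h (i k) k].

Definition star : set 'M[R]_(S, K) := [set h | forall k, col k h <> 0].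

Definition scale_equiv h g : Prop :=
  exists2 lam : 'I_K -> R,
    \prod_k lam k = 1 & forall k, col k h = lam k *: col k g.

Definition scale_class h : set 'M[R]_(S, K) :=
  [set h' | star h' /\ scale_equiv h' h].

Definition diag : set 'M[R]_(S, K) :=
  [set h | star h /\
    forall k k1 : 'I_K, k1 = 0%N :> nat ->
      linfnorm (mxentries (col k h)) = linfnorm (mxentries (col k1 h))].

Definition class_dist (p : \bar R) (C D : set 'M[R]_(S, K)) : R :=
  inf [set lpnorm p (mxentries (x.1 - x.2)) |
       x in (C `&` diag) `*` (D `&` diag)].

End Factors.

(* [A 0 *m ... *m A n.-1] *)
Fixpoint mxchain (R : realType) (d : nat -> nat) (n : nat) :
    (forall k : 'I_n, 'M[R]_(d k, d k.+1)) -> 'M[R]_(d 0%N, d n) :=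
  match n with
  | 0%N => fun _ => 1%:M
  | n'.+1 => fun A =>
      mxchain (fun k : 'I_n' => A (widen_ord (leqnSn n') k)) *m A ord_max
  end.

Definition network (R : realType) (S K : nat) (d : nat -> nat)
    (M : forall k : 'I_K, {linear 'cV[R]_S -> 'M[R]_(d k, d k.+1)})
    (h : 'M[R]_(S, K)) : 'M[R]_(d 0%N, d K) :=
  mxchain (fun k => M k (col k h)).

Section SingularValues.
Variable R : realType.

Definition singular_value (p q : nat) (B : 'M[R]_(p, q)) (s : R) : Prop :=
  0 <= s /\ eigenvalue (B^T *m B) (s ^+ 2).

Variables (S K m n : nat).

Definition tensor_delta (i : {ffun 'I_K -> 'I_S}) : tensor R S K :=
  [ffun j => (j == i)%:R].

(* Matrix of [A] in the canonical (orthonormal) bases, the coordinates of a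
   matrix being listed by [mxvec]. *)
Definition tensor_mx (A : {linear tensor R S K -> 'M[R]_(m, n)}) :
    'M[R]_(m * n, #|{ffun 'I_K -> 'I_S}|) :=
  \matrix_(a, b) mxvec (A (tensor_delta (enum_val b))) 0 a.

(* For [A] nonzero this is an infimum over a nonempty finite set, that is, a
   minimum. *)
Definition sigma_min (A : {linear tensor R S K -> 'M[R]_(m, n)}) : R :=
  inf [set s | singular_value (tensor_mx A) s /\ s <> 0].

End SingularValues.

Definition deep_NSP (R : realType) (S K m n : nat)
    (A : {linear tensor R S K -> 'M[R]_(m, n)})
    (Mod : nat -> set 'M[R]_(S, K)) (gamma rho : R) : Prop :=
  forall (L L' : nat) (T : tensor R S K),
    (exists h g, [/\ Mod L h, Mod L' g & T = segre h - segre g]) ->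
    l2norm (mxentries (A T)) <= rho ->
    forall T' : tensor R S K, A T' = 0 -> l2norm T <= gamma * l2norm (T - T').

(* Main.v *)
Require Import Defs.
From HB Require Import structures.
From mathcomp Require Import all_boot all_order all_algebra.
From mathcomp Require Import all_classical all_reals.
From mathcomp Require Import ereal exp.
From mathcomp Require Import complex ring lra.

(* With [T = P(hstar) - P(hbar)] one has [|A T| <= delta + eta <= rho]; choosing
   [T'] in the null space property so that [T - T'] is the projection of [T] on
   the orthogonal of [Ker A] gives [|T - T'| <= |A T| / sigma_min].

   For the second bound, let [a = |P(h)|_oo >= |P(g)|_oo] and
   [e = |P(h) - P(g)|_oo < a].  Scale [h] and [g] so that every column has
   sup-norm [|P(h)|_oo^(1/K)], resp. [|P(g)|_oo^(1/K)].  At a multi-index [i]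
   where [|P(h)_i| = a], the numbers [P(h)_i] and [P(g)_i] have the same sign,
   so the signs of the columns of [g] can be matched to those of [h] along [i]
   without leaving the class.  Changing one coordinate of [i] then exhibits each
   entry of [h] and [g] as a tensor entry divided by a product of [K - 1]
   matched factors, and the entries differ by at most [2 e a^(1/K - 1)]. *)

Set Implicit Arguments.
Unset Strict Implicit.
Unset Printing Implicit Defensive.

Import Order.TTheory GRing.Theory Num.Theory.

Local Open Scope classical_set_scope.
Local Open Scope ring_scope.

(** * Diagonalization of real symmetric matrices through the complex spectral theorem *)

Section SymmetricSpectrum.
Local Open Scope sesquilinear_scope.
Variables (R : rcfType) (n : nat).
Local Notation toC := (map_mx (real_complex R)).

Lemma conj_real_mx m p (A : 'M[R]_(m, p)) : (toC A) ^t* = toC A^T.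
Proof.
apply/matrixP=> i j; rewrite !mxE.
by apply/CrealP/complex_realP; exists (A j i).
Qed.

(** Over [R[i]] a real symmetric matrix is Hermitian, hence unitarily diagonalizable with real
    eigenvalues. The eigenbasis [P] stays complex; only the spectrum [r] is brought back to [R]. *)
Lemma symmetric_spectral (G : 'M[R]_n) : G^T = G ->
  exists (P : 'M[R[i]]_n) (r : 'rV[R]_n),
    P \is unitarymx /\ P *m (toC G) = diag_mx (toC r) *m P.
Proof.
move=> Gsym.
have Greal : (toC G) \is a mxOver Num.real.
  by apply/mxOverP=> i j; rewrite mxE; apply/complex_realP; exists (G i j).
have Gherm : (toC G) \is hermsymmx.
  apply: realsym_hermsym => //; apply/is_hermitianmxP.
  by rewrite expr0 scale1r map_mx_id // map_trmx Gsym.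
have /mxOverP D_real := hermitian_spectral_diag_real Gherm.
have /orthomx_spectralP G_eq := hermitian_normalmx Gherm.
exists (spectralmx (toC G)), (\row_i complex.Re (spectral_diag (toC G) 0 i)).
split; first exact: spectral_unitarymx.
rewrite [X in _ *m X = _]G_eq !mulmxA mulmxV ?spectral_unit // mul1mx.
by congr (diag_mx _ *m _); apply/rowP=> i; rewrite !mxE RRe_real.
Qed.

Variables (G : 'M[R]_n) (P : 'M[R[i]]_n) (r : 'rV[R]_n).
Hypotheses (Punit : P \is unitarymx) (PG : P *m (toC G) = diag_mx (toC r) *m P).

(** Being a root of the characteristic polynomial is insensitive to the extension from [R] to
    [R[i]], where the rows of [P] form a basis of eigenvectors. *)
Lemma eigenvalue_spectral (a : R) : eigenvalue G a <-> exists i, a = r 0 i.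
Proof.
have Pu := unitarymx_unit Punit.
have -> : eigenvalue G a = eigenvalue (toC G) (real_complex R a).
  by rewrite !eigenvalue_root_char -map_char_poly fmorph_root.
split=> [/eigenvalueP[v vG v0]|[i ->]]; last first.
  apply/eigenvalueP; exists (row i P).
    rewrite -row_mul PG; apply/rowP=> j.
    by rewrite mxE mul_diag_mx !mxE.
  apply/eqP=> Pi0; have : delta_mx 0 i *m P = 0 :> 'rV_n by rewrite -rowE.
  move/(congr1 (mulmx^~ (invmx P))); rewrite mulmxK // mul0mx.
  by move/rowP/(_ i); rewrite !mxE !eqxx => /eqP; rewrite oner_eq0.
pose w := v *m invmx P.
have vE : v = w *m P by rewrite mulmxKV.
have w0 : w != 0 by apply: contraNneq v0 => w0; rewrite vE w0 mul0mx.
have [i wi] : exists i, w 0 i != 0.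
  by have /rV0Pn := w0.
exists i; apply: (@complexI R); apply: (mulIf wi).
move: vG; rewrite vE -mulmxA PG mulmxA scalemxAl => /(can_inj (mulmxK Pu)).
by move=> /rowP/(_ i); rewrite mul_mx_diag !mxE mulrC => ->.
Qed.

(* The range condition [z = y *m G] kills the coordinates along [ker G]. *)
Lemma spectral_range_ge (c : R) (y z : 'rV[R]_n) :
  (forall i, r 0 i != 0 -> c <= r 0 i) -> z = y *m G ->
  c * (z *m z^T) 0 0 <= (z *m G *m z^T) 0 0.
Proof.
move=> rge zyG; have Pu := unitarymx_unit Punit.
have PP : P *m P ^t* = 1%:M by apply/unitarymxP.
(* [w] holds the coordinates of [z] in the eigenbasis; its second expression exhibits the factor
   [r 0 i] in each of them. Both quadratic forms become weighted sums of [|w 0 i|^2], compared term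
   by term. *)
have [w zE wE] : exists2 w, toC z = w *m P &
    w = (toC y *m P ^t*) *m diag_mx (toC r).
  exists (toC z *m P ^t*); first by rewrite -(invmx_unitary Punit) mulmxKV.
  rewrite zyG map_mxM -[RHS]mulmxA -mulmxA; congr (_ *m _).
  rewrite -[toC G]mul1mx -(mulVmx Pu) -!mulmxA [P *m _]mulmxA PG.
  by rewrite invmx_unitary // -!mulmxA PP mulmx1.
have zHE : toC z^T = P ^t* *m w ^t*.
  by rewrite -conj_real_mx zE trmx_mul map_mxM.
rewrite -lecR (rmorphM (real_complex R)) /=.
have -> : real_complex R ((z *m z^T) 0 0) = \sum_i `|w 0 i| ^+ 2.
  transitivity (toC (z *m z^T) 0 0); first by rewrite [in RHS]mxE.
  rewrite map_mxM zHE zE -mulmxA (mulmxA P) PP mul1mx mxE.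
  by apply: eq_bigr => i _; rewrite !mxE normCK.
have -> : real_complex R ((z *m G *m z^T) 0 0) =
    \sum_i real_complex R (r 0 i) * `|w 0 i| ^+ 2.
  transitivity (toC (z *m G *m z^T) 0 0); first by rewrite [in RHS]mxE.
  rewrite !map_mxM zHE zE -(mulmxA w) PG -!mulmxA (mulmxA P) PP mul1mx.
  rewrite [LHS]mxE; apply: eq_bigr => i _.
  by rewrite mul_diag_mx !mxE normCK mulrCA.
rewrite mulr_sumr; apply: ler_sum => i _.
have [ri0|ri0] := eqVneq (r 0 i) 0.
  by rewrite wE mul_mx_diag !mxE ri0 mulr0 normr0 expr0n /= !mulr0.
by rewrite ler_wpM2r ?exprn_ge0 // lecR rge.
Qed.
End SymmetricSpectrum.

(** * The smallest nonzero singular value and the distance to the kernel *)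

Section SmallestSingularValue.
Variable R : realType.

Lemma dotmxE n (v : 'rV[R]_n) : (v *m v^T) 0 0 = \sum_i v 0 i ^+ 2.
Proof. by rewrite mxE; apply: eq_bigr => i _; rewrite mxE. Qed.

Lemma dotmx_ge0 n (v : 'rV[R]_n) : 0 <= (v *m v^T) 0 0.
Proof. by rewrite dotmxE sumr_ge0 // => i _; rewrite sqr_ge0. Qed.

Lemma mulmx_tr_eq0 m n (A : 'M[R]_(m, n)) : A *m A^T = 0 -> A = 0.
Proof.
move=> A0; apply/matrixP=> i j; rewrite [RHS]mxE.
have /eqP := congr1 (fun M : 'M__ => M i i) A0.
rewrite !mxE psumr_eq0 => [/allP/(_ j)|k _]; rewrite mxE -expr2 ?sqr_ge0 //.
by rewrite mem_index_enum sqrf_eq0 => /(_ isT)/eqP.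
Qed.

Variables (p q : nat) (B : 'M[R]_(p, q)).
Hypothesis B_neq0 : B != 0.
Let G := B^T *m B.
Let sv := [set s | singular_value B s /\ s <> 0].

Let Gsym : G^T = G. Proof. by rewrite trmx_mul trmxK. Qed.

Let gram_dot (v : 'rV[R]_q) : v *m G *m v^T = (v *m B^T) *m (v *m B^T)^T.
Proof. by rewrite trmx_mul trmxK !mulmxA. Qed.

Let gram_eigenvalue_ge0 (a : R) : eigenvalue G a -> 0 <= a.
Proof.
case/eigenvalueP=> v vG v0.
have v_gt0 : 0 < (v *m v^T) 0 0.
  rewrite lt_def dotmx_ge0 andbT; apply: contraNneq v0 => vv0.
  by apply/eqP/mulmx_tr_eq0; rewrite [LHS]mx11_scalar vv0 raddf0.
rewrite -(pmulr_lge0 _ v_gt0).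
have -> : a * (v *m v^T) 0 0 = (v *m G *m v^T) 0 0.
  by rewrite vG -scalemxAl [RHS]mxE.
by rewrite gram_dot dotmx_ge0.
Qed.

(** Hides the complex eigenbasis of the Gram matrix: from here on only its real spectrum [r] is
    used, whose nonzero entries are the squares of the nonzero singular values. *)
Let gram_spectrum : exists r : 'rV[R]_q,
  [/\ forall s, sv s <-> exists2 i, r 0 i != 0 & s = Num.sqrt (r 0 i),
      exists i, r 0 i != 0, forall i, 0 <= r 0 i &
      forall c (y z : 'rV[R]_q), (forall i, r 0 i != 0 -> c <= r 0 i) ->
        z = y *m G ->
        c * (z *m z^T) 0 0 <= (z *m G *m z^T) 0 0].
Proof.
have [P [r [Punit PG]]] := symmetric_spectral Gsym.
have r_eigen := eigenvalue_spectral Punit PG.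
have r_ge0 i : 0 <= r 0 i.
  by apply: gram_eigenvalue_ge0; apply/r_eigen; exists i.
exists r; split=> //; last by move=> c y z; exact: (spectral_range_ge Punit PG).
  move=> s; split=> [[[s_ge0 /r_eigen[i si]] s0]|[i ri0 ->]].
    exists i; first by rewrite -si sqrf_eq0; apply/eqP.
    by rewrite -si sqrtr_sqr ger0_norm.
  split; last by apply/eqP; rewrite sqrtr_eq0 -ltNge lt_def ri0 r_ge0.
  by split; [exact: sqrtr_ge0|rewrite sqr_sqrtr //; apply/r_eigen; exists i].
(* If all eigenvalues vanished, the diagonalization would give [G = 0], hence [B = 0]. *)
apply/existsP; rewrite -[X in is_true X]negbK negb_exists.
apply: contraNN B_neq0 => /forallP r0.
have := PG; have -> : r = 0.
  by apply/rowP=> i; rewrite mxE; apply/eqP; have := r0 i; rewrite negbK.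
rewrite map_mx0 linear0 mul0mx => /(canRL (mulKmx (unitarymx_unit Punit))).
rewrite mulmx0 => /eqP; rewrite map_mx_eq0 => /eqP G0.
by apply/eqP/trmx_inj; rewrite trmx0; apply: mulmx_tr_eq0; rewrite trmxK.
Qed.

(** The spectrum is finite, so the square root of its least nonzero entry is a positive lower bound;
    [B != 0] makes the set nonempty, which matters because the infimum of the empty set is 0. *)
Lemma inf_singular_value_gt0 : 0 < inf sv.
Proof.
have [r [svE [i ri0] r_ge0 _]] := gram_spectrum.
pose j := [arg min_(j < i | r 0 j != 0) r 0 j]%O.
have [rj0 rj_min] : r 0 j != 0 /\ forall k, r 0 k != 0 -> r 0 j <= r 0 k.
  by rewrite /j; case: arg_minP => // k rk0 rk_min; split.
apply: (@lt_le_trans _ _ (Num.sqrt (r 0 j))).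
  by rewrite sqrtr_gt0 lt_def rj0 r_ge0.
apply: lb_le_inf; first by exists (Num.sqrt (r 0 i)); apply/svE; exists i.
by move=> _ /svE[k rk0 ->]; rewrite ler_wsqrtr // rj_min.
Qed.

(** [x - x0] is the projection of [x] on the range of [G], the orthogonal of the kernel of [B];
    there the quadratic form of [G] is at least the least nonzero eigenvalue times the squared
    norm. *)
Lemma singular_value_kernel_approx (x : 'rV[R]_q) :
  exists2 x0 : 'rV[R]_q, x0 *m B^T = 0 &
    inf sv ^+ 2 * ((x - x0) *m (x - x0)^T) 0 0
      <= ((x *m B^T) *m (x *m B^T)^T) 0 0.
Proof.
have [r [svE _ r_ge0 range_ge]] := gram_spectrum.
(* [G] and [G *m G] have the same row space: if [G *m G *m C = 0], then by symmetry
   [(G *m C)^T *m (G *m C) = 0], so [G *m C = 0]. *)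
have G_sub : (G <= G *m G)%MS.
  rewrite submxE; set C := cokermx _; apply/eqP/trmx_inj; rewrite trmx0.
  apply: mulmx_tr_eq0; rewrite trmxK trmx_mul Gsym -mulmxA (mulmxA G).
  by rewrite mulmx_coker mulmx0.
have /submxP[y xE] : (x *m G <= G *m G)%MS.
  by rewrite (submx_trans (submxMl _ _)).
(* By the choice of [y], [z *m G = x *m G], so the form of [G] vanishes at [z - x], which therefore
   lies in the kernel of [B]. *)
pose z := y *m G; have zB : z *m B^T = x *m B^T.
  apply/eqP; rewrite -subr_eq0 -mulmxBl; apply/eqP/mulmx_tr_eq0.
  by rewrite -gram_dot mulmxBl -mulmxA -xE subrr mul0mx.
exists (x - z); first by rewrite mulmxBl zB subrr.
rewrite subKr -zB -gram_dot; apply: (range_ge _ y) => // i ri0.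
rewrite -(sqr_sqrtr (r_ge0 i)); apply: lerXn2r; rewrite ?nnegrE ?sqrtr_ge0 //.
  exact: ltW inf_singular_value_gt0.
apply: ge_inf; last by apply/svE; exists i.
by exists 0 => s [[]].
Qed.
End SmallestSingularValue.

(** * Euclidean, sup and p-norms on finite families *)

Section Norms.
Variables (R : realType) (I : finType).
Implicit Types f g : I -> R.

Lemma l2norm_ge0 f : 0 <= l2norm f.
Proof. exact: sqrtr_ge0. Qed.

Lemma sqr_l2norm f : l2norm f ^+ 2 = \sum_i f i ^+ 2.
Proof. by rewrite sqr_sqrtr // sumr_ge0 // => i _; rewrite sqr_ge0. Qed.

Lemma le_l2norm f i : `|f i| <= l2norm f.
Proof.
rewrite -sqrtr_sqr ler_wsqrtr // (bigD1 i) //= lerDl sumr_ge0 // => j _.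
exact: sqr_ge0.
Qed.

(** Cauchy-Schwarz, by expanding the sum of the squares of [b * f i - a * g i], where [a] and [b]
    are the two norms. The result carries a factor [a * b], so zero norms are treated first. *)
Lemma l2norm_dot_le f g : \sum_i f i * g i <= l2norm f * l2norm g.
Proof.
set a := l2norm f; set b := l2norm g; set s := \sum_i _.
have [a0|/negPf a0] := eqVneq a 0.
  rewrite a0 mul0r /s big1 // => i _.
  by have := le_l2norm f i; rewrite -/a a0 normr_le0 => /eqP->; rewrite mul0r.
have [b0|/negPf b0] := eqVneq b 0.
  rewrite b0 mulr0 /s big1 // => i _.
  by have := le_l2norm g i; rewrite -/b b0 normr_le0 => /eqP->; rewrite mulr0.
have a_gt0 : 0 < a by rewrite lt_def a0 l2norm_ge0.
have b_gt0 : 0 < b by rewrite lt_def b0 l2norm_ge0.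
rewrite -(ler_pM2l (mulr_gt0 a_gt0 b_gt0)).
have : 0 <= \sum_i (b * f i - a * g i) ^+ 2.
  by rewrite sumr_ge0 // => i _; rewrite sqr_ge0.
have -> : \sum_i (b * f i - a * g i) ^+ 2 =
    b ^+ 2 * \sum_i f i ^+ 2 - 2 * (a * b) * s + a ^+ 2 * \sum_i g i ^+ 2.
  rewrite /s !mulr_sumr -sumrB -big_split /=.
  by apply: eq_bigr => i _; ring.
by rewrite -!sqr_l2norm -/a -/b; nra.
Qed.

Lemma l2normD f g : l2norm (fun i => f i + g i) <= l2norm f + l2norm g.
Proof.
rewrite -ler_sqr ?nnegrE ?addr_ge0 ?l2norm_ge0 // sqr_l2norm.
have -> : \sum_i (f i + g i) ^+ 2 =
    \sum_i f i ^+ 2 + 2 * (\sum_i f i * g i) + \sum_i g i ^+ 2.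
  rewrite mulr_sumr -!big_split /=.
  by apply: eq_bigr => i _; ring.
by have := l2norm_dot_le f g; rewrite -!sqr_l2norm; nra.
Qed.

Lemma le_linfnorm f i : `|f i| <= linfnorm f.
Proof. exact: (le_bigmax _ (fun i => `|f i|)). Qed.

Lemma linfnorm_le f c : 0 <= c -> (forall i, `|f i| <= c) -> linfnorm f <= c.
Proof. by move=> c0 fc; apply: bigmax_le. Qed.

Lemma linfnorm_ge0 f : 0 <= linfnorm f.
Proof. exact: bigmax_ge_id. Qed.

Lemma linfnorm_eq (i0 : I) f : exists i, linfnorm f = `|f i|.
Proof.
by have [i _ fi] := @eq_bigmax _ _ _ (0 : R) i0 xpredT (fun i => `|f i|) isT
  (fun i _ => normr_ge0 _); exists i.
Qed.

Lemma lpnorm_ge0 (p : \bar R) f : 0 <= lpnorm p f.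
Proof. by case: p => [r| |] //=; [exact: powR_ge0|exact: linfnorm_ge0]. Qed.

(** Source of the factor [(KS)^(1/p)]; at [p = +oo] the exponent is 0 and the factor is 1. *)
Lemma lpnorm_le_card (p : \bar R) f c : (1%:E <= p)%E -> 0 <= c ->
  (forall i, `|f i| <= c) -> lpnorm p f <= #|I|%:R `^ exponent_inv p * c.
Proof.
move=> p1 c0 fc; case: p p1 => [r| |] //=; last first.
  by move=> _; rewrite powRr0 mul1r; apply: linfnorm_le.
rewrite lee_fin => r1; have r0 : 0 < r by exact: lt_le_trans r1.
have -> : c = (c `^ r) `^ r^-1 by rewrite -powRrM mulfV ?lt0r_neq0 ?powRr1.
rewrite -powRM ?ler0n ?powR_ge0 //.
apply: ge0_ler_powR; rewrite ?nnegrE ?invr_ge0 ?(ltW r0) //.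
- by rewrite sumr_ge0 // => i _; rewrite powR_ge0.
- by rewrite mulr_ge0 ?ler0n ?powR_ge0.
rewrite mulr_natl -sumr_const; apply: ler_sum => i _.
by apply: ge0_ler_powR; rewrite ?nnegrE ?(ltW r0).
Qed.
End Norms.

(** * Transfer of the kernel estimate to operators on tensors *)

Section TensorKernel.
Variable R : realType.

Lemma l2norm_mxentries m n (X : 'M[R]_(m, n)) :
  l2norm (mxentries X) = Num.sqrt ((mxvec X *m (mxvec X)^T) 0 0).
Proof.
congr Num.sqrt; rewrite dotmxE (reindex _ (curry_mxvec_bij _ _)) /=.
by apply: eq_bigr => -[i j] _; rewrite mxvecE.
Qed.

Lemma l2norm_mxB m n (X Y : 'M[R]_(m, n)) :
  l2norm (mxentries (X - Y)) <= l2norm (mxentries X) + l2norm (mxentries Y).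
Proof.
have -> : l2norm (mxentries Y) = l2norm (fun ij => - mxentries Y ij).
  by congr Num.sqrt; apply: eq_bigr => ij _; rewrite sqrrN.
apply: le_trans (l2normD _ _); rewrite le_eqVlt; apply/orP; left; apply/eqP.
by congr Num.sqrt; apply: eq_bigr => ij _; rewrite /mxentries !mxE.
Qed.

Variables (S K m n : nat) (A : {linear tensor R S K -> 'M[R]_(m, n)}).

Definition tensor_coords (T : tensor R S K) : 'rV[R]_#|{ffun 'I_K -> 'I_S}| :=
  \row_b T (enum_val b).

Lemma tensor_coordsK (x : 'rV[R]_#|{ffun 'I_K -> 'I_S}|) :
  tensor_coords [ffun i => x 0 (enum_rank i)] = x.
Proof. by apply/rowP=> b; rewrite mxE ffunE enum_valK. Qed.

Lemma tensor_coordsB T T' :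
  tensor_coords (T - T') = tensor_coords T - tensor_coords T'.
Proof. by apply/rowP=> b; rewrite !mxE !ffunE. Qed.

Lemma l2norm_tensor (T : tensor R S K) :
  l2norm T = Num.sqrt ((tensor_coords T *m (tensor_coords T)^T) 0 0).
Proof.
congr Num.sqrt; rewrite dotmxE (reindex _ (onW_bij _ (enum_val_bij _))) /=.
by apply: eq_bigr => b _; rewrite mxE.
Qed.

Lemma tensor_sum_delta (T : tensor R S K) : T = \sum_i T i *: tensor_delta R i.
Proof.
apply/ffunP=> j; rewrite sum_ffunE (bigD1 j) //= big1 => [|i ij].
  by rewrite !ffunE eqxx addr0 [RHS]mulr1.
by rewrite !ffunE eq_sym (negbTE ij) [LHS]mulr0.
Qed.

(** Coordinates are row vectors, so the operator acts by the transposed matrix on the right, as in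
    [singular_value_kernel_approx]. *)
Lemma tensor_mxE (T : tensor R S K) :
  tensor_coords T *m (tensor_mx A)^T = mxvec (A T).
Proof.
apply/rowP=> a; rewrite [in RHS](tensor_sum_delta T) !linear_sum /= summxE mxE.
rewrite [RHS](reindex _ (onW_bij _ (enum_val_bij _))) /=.
by apply: eq_bigr => b _; rewrite !mxE !linearZ mxE.
Qed.

Hypothesis A_neq0 : exists T, A T <> 0.

Let tensor_mx_neq0 : tensor_mx A != 0.
Proof.
have [T AT0] := A_neq0; apply: contra_notN AT0 => /eqP A0.
by apply: (can_inj mxvecK); rewrite -tensor_mxE A0 trmx0 mulmx0 linear0.
Qed.

Lemma sigma_min_gt0 : 0 < sigma_min A.
Proof. exact: inf_singular_value_gt0. Qed.

(** [tensor_coords] and [mxvec] preserve the Euclidean norms, so the matrix estimate carries over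
    after taking square roots. *)
Lemma tensor_kernel_approx (T : tensor R S K) :
  exists2 T', A T' = 0 &
    sigma_min A * l2norm (T - T') <= l2norm (mxentries (A T)).
Proof.
have [x0 x0_ker x0_le] :=
  singular_value_kernel_approx tensor_mx_neq0 (tensor_coords T).
exists [ffun i => x0 0 (enum_rank i)].
  by apply: (can_inj mxvecK); rewrite -tensor_mxE tensor_coordsK x0_ker linear0.
rewrite l2norm_tensor tensor_coordsB tensor_coordsK l2norm_mxentries.
rewrite -(ger0_norm (ltW sigma_min_gt0)) -sqrtr_sqr -sqrtrM ?sqr_ge0 //.
by rewrite ler_wsqrtr // -tensor_mxE.
Qed.
End TensorKernel.

(** * The Segre map: column norms, rescaling, and recovery of the factors *)

Section Segre.
Variables (R : realType) (S K : nat).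
Implicit Types h g : 'M[R]_(S, K).

Definition colnorm h (k : 'I_K) : R := linfnorm (mxentries (col k h)).

Lemma le_colnorm h j k : `|h j k| <= colnorm h k.
Proof.
by have := le_linfnorm (mxentries (col k h)) (j, 0); rewrite /mxentries mxE.
Qed.

Lemma colnorm_gt0 h k : star h -> 0 < colnorm h k.
Proof.
move=> /(_ k) hk0; rewrite lt_def linfnorm_ge0 andbT; apply/eqP => N0.
apply: hk0; apply/colP=> j; have := le_colnorm h j k.
by rewrite N0 normr_le0 !mxE => /eqP.
Qed.

Lemma star_segre h : segre h != 0 -> star h.
Proof.
move=> Ph0 k hk0; move/eqP: Ph0; apply; apply/ffunP=> i; rewrite !ffunE.
rewrite (bigD1 k) //=; have /colP/(_ (i k)) := hk0.
by rewrite !mxE => ->; rewrite mul0r.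
Qed.

Definition scale_cols (lam : 'I_K -> R) h : 'M[R]_(S, K) :=
  \matrix_(i, k) (lam k * h i k).

Lemma scale_class_scale_cols lam h :
  star h -> \prod_k lam k = 1 -> scale_class h (scale_cols lam h).
Proof.
move=> h_star lam1.
have colE k : col k (scale_cols lam h) = lam k *: col k h.
  by apply/colP=> j; rewrite !mxE.
split; last by exists lam.
move=> k /eqP; rewrite colE scaler_eq0 => /orP[/eqP lamk0|/eqP]; last first.
  exact: h_star.
by have /eqP := lam1; rewrite (bigD1 k) //= lamk0 mul0r eq_sym oner_eq0.
Qed.

Lemma segre_scale_cols lam h :
  \prod_k lam k = 1 -> segre (scale_cols lam h) = segre h.
Proof.
move=> lam1; apply/ffunP=> i; rewrite !ffunE.
by under eq_bigr do rewrite mxE; rewrite big_split /= lam1 mul1r.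
Qed.

Hypothesis S_gt0 : (0 < S)%N.

(** One multi-index collects a maximal entry of every column; at it [|segre h i|] is the product of
    the column norms. *)
Lemma colnorm_attained h : exists i : {ffun 'I_K -> 'I_S},
  forall k, colnorm h k = `|h (i k) k|.
Proof.
suff /fin_all_exists[i iP] : forall k, exists j, colnorm h k = `|h j k|.
  by exists (finfun i) => k; rewrite ffunE.
move=> k; have [[j z]] := linfnorm_eq (Ordinal S_gt0, 0) (mxentries (col k h)).
by rewrite /mxentries mxE; exists j.
Qed.

Lemma linfnorm_segre h : linfnorm (segre h) = \prod_k colnorm h k.
Proof.
apply/le_anti/andP; split.
  apply: linfnorm_le => [|i].
    by rewrite prodr_ge0 // => k _; exact: linfnorm_ge0.
  rewrite ffunE normr_prod; apply: ler_prod => k _.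
  by rewrite normr_ge0 le_colnorm.
have [i iP] := colnorm_attained h.
apply: le_trans (le_linfnorm _ i); rewrite ffunE normr_prod.
by rewrite le_eqVlt (eq_bigr _ (fun k _ => iP k)) eqxx.
Qed.

Lemma colnorm_scale_cols lam h k :
  colnorm (scale_cols lam h) k = `|lam k| * colnorm h k.
Proof.
apply/le_anti/andP; split.
  apply: linfnorm_le => [|[j z]].
    by rewrite mulr_ge0 ?normr_ge0 ?linfnorm_ge0.
  by rewrite /mxentries !mxE normrM ler_wpM2l ?normr_ge0 ?le_colnorm.
have [i iP] := colnorm_attained h.
by rewrite iP -normrM; apply: le_trans (le_colnorm _ (i k) _); rewrite mxE.
Qed.

(* The entry [(j, k)] is read off the tensors at the multi-index obtained from
   [i] by replacing [i k] with [j]. *)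
Lemma segre_entry_dist h g (alpha e : R) (i : {ffun 'I_K -> 'I_S})
    (s : 'I_K -> R) :
  0 < alpha -> (forall k, `|s k| = 1) ->
  (forall k, h (i k) k = s k * alpha) ->
  (forall k, g (i k) k = s k * `|g (i k) k|) ->
  (forall j k, `|g j k| <= alpha) ->
  (forall x, `|segre h x - segre g x| <= e) ->
  forall j k, alpha ^+ K.-1 * `|h j k - g j k| <= 2 * e.
Proof.
move=> alpha_gt0 s1 hi gi g_le Phg j k.
pose sig := \prod_(l < K | l != k) s l.
pose c := \prod_(l < K | l != k) `|g (i l) l|.
have sig1 : `|sig| = 1 by rewrite normr_prod big1.
have segre_at f jj : segre f [ffun l => if l == k then jj else i l] =
    f jj k * \prod_(l < K | l != k) f (i l) l.
  rewrite ffunE (bigD1 k) //= ffunE eqxx; congr (_ * _).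
  by apply: eq_bigr => l /negbTE lk; rewrite ffunE lk.
have hk : \prod_(l < K | l != k) h (i l) l = sig * alpha ^+ K.-1.
  rewrite (eq_bigr _ (fun l _ => hi l)) big_split /= prodr_const.
  by rewrite cardC1 card_ord.
have gk : \prod_(l < K | l != k) g (i l) l = sig * c.
  by rewrite (eq_bigr _ (fun l _ => gi l)) big_split.
(* The two products over [l != k] share the sign [sig], which drops out of the absolute value. *)
have entry jj : `|h jj k * alpha ^+ K.-1 - g jj k * c| <= e.
  have := Phg [ffun l => if l == k then jj else i l].
  by rewrite !segre_at hk gk !(mulrCA _ sig) -mulrBr normrM sig1 mul1r.
have c_ge0 : 0 <= c by rewrite prodr_ge0 // => l _; exact: normr_ge0.
have c_le : c <= alpha ^+ K.-1.
  have -> : alpha ^+ K.-1 = \prod_(l < K | l != k) alpha.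
    by rewrite prodr_const cardC1 card_ord.
  by apply: ler_prod => l _; rewrite normr_ge0 g_le.
(* The bound [entry] at [jj = i k], that is, at the multi-index [i] itself, combined with
   [|g (i k) k| <= alpha]. *)
have c_ge : (alpha ^+ K.-1 - c) * alpha <= e.
  have := entry (i k); rewrite hi gi -!mulrA -mulrBr normrM s1 mul1r.
  move=> /(le_trans (ler_norm _)); apply: le_trans.
  rewrite mulrBl mulrC lerD2l lerN2 [leRHS]mulrC ler_wpM2r //.
(* Each of the two terms of this splitting is at most [e], by [entry] and by [c_ge]; hence the
   factor 2. *)
have -> : alpha ^+ K.-1 * `|h j k - g j k| =
    `|(h j k * alpha ^+ K.-1 - g j k * c) - g j k * (alpha ^+ K.-1 - c)|.
  rewrite -[X in X * _](@ger0_norm _ (alpha ^+ K.-1)); last first.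
    by rewrite exprn_ge0 ?ltW.
  by rewrite -normrM; congr `|_|; ring.
apply: le_trans (ler_normB _ _) _; rewrite mulr2n mulrDl !mul1r lerD //.
apply: le_trans c_ge.
rewrite normrM mulrC (ger0_norm (x := _ - _)) ?subr_ge0 //.
by rewrite ler_wpM2l ?subr_ge0.
Qed.

Hypothesis K_gt0 : (0 < K)%N.

Lemma powR_inv_expn (a : R) : 0 <= a -> (a `^ K%:R^-1) ^+ K = a.
Proof.
move=> a0; rewrite -powR_mulrn ?powR_ge0 // -powRrM mulVf ?powRr1 //.
by rewrite pnatr_eq0 -lt0n.
Qed.

(** Links the exponent [1/K - 1] of the final bound to the division by [K - 1] factors in
    [segre_entry_dist]. *)
Lemma powR_inv_expn_pred (a : R) : 0 < a ->
  a `^ (K%:R^-1 - 1) = ((a `^ K%:R^-1) ^+ K.-1)^-1.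
Proof.
move=> a0; have a_neq0 := lt0r_neq0 a0.
have aK0 : a `^ K%:R^-1 != 0 by rewrite lt0r_neq0 ?powR_gt0.
rewrite powRD; last by rewrite a_neq0 implybT.
rewrite powR_inv1 ?(ltW a0) // -[X in _ * X^-1](powR_inv_expn (ltW a0)).
by rewrite -[X in _ ^+ X](prednK K_gt0) exprS invfM mulrA mulfV ?mul1r.
Qed.

Lemma balanced_diag lam h (c : R) : star (scale_cols lam h) ->
  (forall k, `|lam k| * colnorm h k = c) -> diag (scale_cols lam h).
Proof.
move=> ? lamh; split=> // k k1 _.
by rewrite -!/(colnorm _ _) !colnorm_scale_cols !lamh.
Qed.

Lemma linfnorm_segre_gt0 h : star h -> 0 < linfnorm (segre h).
Proof.
move=> h_star; rewrite linfnorm_segre prodr_gt0 // => k _.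
exact: colnorm_gt0.
Qed.

Lemma diag_representatives_dist h g :
  star h -> star g -> linfnorm (segre g) <= linfnorm (segre h) ->
  linfnorm (segre h - segre g) < linfnorm (segre h) ->
  exists h' g', [/\ (scale_class h `&` @diag R S K) h',
    (scale_class g `&` @diag R S K) g' &
    forall j k, `|h' j k - g' j k| <= 2 * linfnorm (segre h - segre g)
                  * linfnorm (segre h) `^ (K%:R^-1 - 1)].
Proof.
move=> h_star g_star.
set a := linfnorm (segre h); set b := linfnorm (segre g).
set e := linfnorm _ => ba ea.
have a_gt0 : 0 < a by exact: linfnorm_segre_gt0.
have b_gt0 : 0 < b by exact: linfnorm_segre_gt0.
pose alpha := a `^ K%:R^-1; pose beta := b `^ K%:R^-1.
have alpha_gt0 : 0 < alpha by exact: powR_gt0.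
have beta_gt0 : 0 < beta by exact: powR_gt0.
have beta_le : beta <= alpha.
  by apply: ge0_ler_powR => //; rewrite ?nnegrE ?invr_ge0 ?ler0n ?ltW.
have [i iP] := colnorm_attained h.
have Phg x : `|segre h x - segre g x| <= e.
  by have := le_linfnorm (segre h - segre g) x; rewrite !ffunE.
have Phi : `|segre h i| = a.
  rewrite /a linfnorm_segre ffunE normr_prod.
  by apply: eq_bigr => k _; rewrite iP.
(* If [segre g i] were zero or of opposite sign, the two entries would be at least [a > e] apart. *)
have sg1 : Num.sg (segre h i) * Num.sg (segre g i) = 1.
  rewrite -sgrM gtr0_sg //.
  have := Phg i; rewrite ler_norml => /andP[lo hi].
  by case: (ler0P (segre h i)) Phi => ? Phi; nra.
have sgP f : Num.sg (segre f i) = \prod_k Num.sg (f (i k) k) :> R.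
  by rewrite ffunE (big_morph _ (@sgrM R) (@sgr1 R)).
have hi0 k : h (i k) k != 0.
  by rewrite -normr_eq0 -iP lt0r_neq0 ?colnorm_gt0.
have gi0 k : g (i k) k != 0.
  apply/eqP=> gik0; move: sg1.
  rewrite [segre g i]ffunE (bigD1 k) //= gik0 mul0r sgr0 mulr0 => /eqP.
  by rewrite eq_sym oner_eq0.
(* [lam] and [mu] bring all column norms to [alpha] and [beta]. Their products are 1 because
   [alpha^K] and [beta^K] are the sup-norms of the tensors and, for [mu], because the sign
   corrections multiply to 1 by [sg1]. *)
pose lam k := alpha / colnorm h k.
pose mu k := Num.sg (h (i k) k) * Num.sg (g (i k) k) * (beta / colnorm g k).
have lam1 : \prod_k lam k = 1.
  rewrite /lam prodf_div -linfnorm_segre prodr_const card_ord.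
  by rewrite powR_inv_expn ?mulfV ?lt0r_neq0 // ltW.
have mu1 : \prod_k mu k = 1.
  rewrite /mu !big_split /= -!sgP sg1 mul1r -big_split /= prodf_div.
  rewrite -linfnorm_segre prodr_const card_ord.
  by rewrite powR_inv_expn ?mulfV ?lt0r_neq0 // ltW.
have lamh k : `|lam k| * colnorm h k = alpha.
  rewrite ger0_norm ?divr_ge0 ?linfnorm_ge0 ?(ltW alpha_gt0) //.
  by rewrite divfK // lt0r_neq0 ?colnorm_gt0.
have mu_norm k : `|mu k| = beta / colnorm g k.
  rewrite !normrM !normr_sg hi0 gi0 !mul1r -normrM.
  by rewrite ger0_norm ?divr_ge0 ?linfnorm_ge0 ?(ltW beta_gt0).
have mug k : `|mu k| * colnorm g k = beta.
  by rewrite mu_norm divfK // lt0r_neq0 ?colnorm_gt0.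
have h'_class := scale_class_scale_cols h_star lam1.
have g'_class := scale_class_scale_cols g_star mu1.
exists (scale_cols lam h), (scale_cols mu g); split.
- by split=> //; apply: balanced_diag lamh; case: h'_class.
- by split=> //; apply: balanced_diag mug; case: g'_class.
move=> j k; rewrite powR_inv_expn_pred // -/alpha.
rewrite ler_pdivlMr ?exprn_gt0 // mulrC.
apply: (@segre_entry_dist _ _ _ _ i (fun k => Num.sg (h (i k) k))) => //.
- by move=> l; rewrite normr_sg hi0.
- move=> l; rewrite mxE -(lamh l) iP ger0_norm; last first.
    by rewrite divr_ge0 ?linfnorm_ge0 ?(ltW alpha_gt0).
  by rewrite mulrCA -numEsg.
- move=> l; rewrite mxE normrM mu_norm /mu.
  rewrite -[Num.sg _ * _ * _]mulrA -[LHS]mulrA; congr (_ * _).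
  by rewrite normrEsg; ring.
- move=> jj l; rewrite mxE normrM; apply: le_trans beta_le; rewrite -(mug l).
  by rewrite ler_wpM2l ?normr_ge0 ?le_colnorm.
- by move=> x; rewrite !segre_scale_cols.
Qed.

Lemma class_dist_le (p : \bar R) h g h' g' c : (1%:E <= p)%E -> 0 <= c ->
  (scale_class h `&` @diag R S K) h' -> (scale_class g `&` @diag R S K) g' ->
  (forall j k, `|h' j k - g' j k| <= c) ->
  class_dist p (scale_class h) (scale_class g)
    <= (K * S)%:R `^ exponent_inv p * c.
Proof.
move=> p1 c0 h'_in g'_in h'g'.
apply: (@le_trans _ _ (lpnorm p (mxentries (h' - g')))).
  apply: ge_inf; last by exists (h', g').
  by exists 0 => _ [x _ <-]; exact: lpnorm_ge0.
have -> : (K * S)%N = #|{: 'I_S * 'I_K}| by rewrite card_prod !card_ord mulnC.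
by apply: lpnorm_le_card => // -[j k]; rewrite /mxentries !mxE h'g'.
Qed.

(** Symmetric form of [diag_representatives_dist]: [key] takes the tensor of larger sup-norm first,
    and the two orderings are handled by exchanging the roles of [h] and [g]. *)
Lemma class_dist_segre_le (p : \bar R) h g e : (1%:E <= p)%E ->
  linfnorm (segre h - segre g) <= e ->
  e < Num.max (linfnorm (segre h)) (linfnorm (segre g)) ->
  class_dist p (scale_class h) (scale_class g)
    <= (K * S)%:R `^ exponent_inv p
       * (2 * e * Num.min (linfnorm (segre h) `^ (K%:R^-1 - 1))
                          (linfnorm (segre g) `^ (K%:R^-1 - 1))).
Proof.
move=> p1 hg_e e_lt.
have e0 : 0 <= e by apply: le_trans hg_e; exact: linfnorm_ge0.
have gh_hg : linfnorm (segre g - segre h) <= linfnorm (segre h - segre g).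
  apply: linfnorm_le => [|x]; first exact: linfnorm_ge0.
  by have := le_linfnorm (segre h - segre g) x; rewrite !ffunE distrC.
have segre0 (f : 'M[R]_(S, K)) : segre f = 0 -> linfnorm (segre f) <= 0.
  by move=> ->; apply: linfnorm_le => // x; rewrite ffunE normr0.
have key f f' : linfnorm (segre f') <= linfnorm (segre f) ->
    linfnorm (segre f - segre f') <= e -> e < linfnorm (segre f) ->
    exists2 f1, (scale_class f `&` @diag R S K) f1 &
    exists2 f2, (scale_class f' `&` @diag R S K) f2 &
    forall j k, `|f1 j k - f2 j k| <= 2 * e
      * Num.min (linfnorm (segre f) `^ (K%:R^-1 - 1))
                (linfnorm (segre f') `^ (K%:R^-1 - 1)).
  move=> f'f ff'_e e_f.
  have f_star : star f.
    apply: star_segre; apply: contraTneq e_f => /segre0 f0.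
    by rewrite -leNgt (le_trans f0).
  (* Were [segre f'] zero, the distance between the tensors would be [linfnorm (segre f)], which
     exceeds [e]. *)
  have f'_star : star f'.
    apply: star_segre; apply: contraTneq e_f => f'0.
    by rewrite -leNgt; move: ff'_e; rewrite f'0 subr0.
  have [f1 [f2 [f1_in f2_in dist]]] :=
    diag_representatives_dist f_star f'_star f'f (le_lt_trans ff'_e e_f).
  exists f1 => //; exists f2 => // j k.
  (* The exponent [1/K - 1] is nonpositive, so the minimum is reached at the larger sup-norm. *)
  rewrite min_l; last first.
    have f'_gt0 := linfnorm_segre_gt0 f'_star.
    have f_gt0 := linfnorm_segre_gt0 f_star.
    rewrite !powR_inv_expn_pred // lef_pV2 ?posrE ?exprn_gt0 ?powR_gt0 //.
    rewrite lerXn2r ?nnegrE ?powR_ge0 //.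
    apply: ge0_ler_powR; rewrite ?invr_ge0 ?ler0n //.
      by rewrite nnegrE ltW.
    by rewrite nnegrE ltW.
  by apply: le_trans (dist j k) _; rewrite ler_wpM2r ?powR_ge0 // ler_wpM2l.
have bound_ge0 : 0 <= 2 * e * Num.min (linfnorm (segre h) `^ (K%:R^-1 - 1))
                                      (linfnorm (segre g) `^ (K%:R^-1 - 1)).
  by rewrite !mulr_ge0 // le_min !powR_ge0.
have [hg|/ltW gh] := leP (linfnorm (segre h)) (linfnorm (segre g)).
  rewrite max_r // in e_lt.
  have [g1 g1_in [h1 h1_in dist]] := key g h hg (le_trans gh_hg hg_e) e_lt.
  by apply: class_dist_le h1_in g1_in _ => // j k; rewrite distrC minC.
rewrite max_l // in e_lt.
have [h1 h1_in [g1 g1_in dist]] := key h g gh hg_e e_lt.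
exact: class_dist_le h1_in g1_in _.
Qed.
End Segre.

(** * Stability of the tensors and of the factor classes *)

Theorem theorem7p2 (R : realType) (K S : nat) (K_ge1 : (1 <= K)%N)
    (S_ge2 : (2 <= S)%N) (d : nat -> nat)
    (M : forall k : 'I_K, {linear 'cV[R]_S -> 'M[R]_(d k, d k.+1)})
    (A : {linear tensor R S K -> 'M[R]_(d 0%N, d K)})
    (A_lift : forall h : 'M[R]_(S, K), network M h = A (segre h))
    (A_neq0 : exists T : tensor R S K, A T <> 0)
    (Mod : nat -> set 'M[R]_(S, K))
    (Mod_neq0 : forall L, Mod L !=set0)
    (gamma rho : R) (gamma_gt0 : 0 < gamma) (rho_gt0 : 0 < rho)
    (A_NSP : deep_NSP A Mod gamma rho)
    (X : 'M[R]_(d 0%N, d K)) (Lbar Lstar : nat) (hbar hstar : 'M[R]_(S, K))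
    (Mod_hbar : Mod Lbar hbar) (Mod_hstar : Mod Lstar hstar)
    (delta eta : R) (delta_ge0 : 0 <= delta) (eta_ge0 : 0 <= eta)
    (hbar_delta : l2norm (mxentries (network M hbar - X)) <= delta)
    (hstar_eta : l2norm (mxentries (network M hstar - X)) <= eta)
    (delta_eta_rho : delta + eta <= rho) :
  l2norm (segre hstar - segre hbar) <= gamma / sigma_min A * (delta + eta) /\
  (star hbar ->
   gamma / sigma_min A * (delta + eta)
     <= 2^-1 * Num.max (linfnorm (segre hbar)) (linfnorm (segre hstar)) ->
   forall p : \bar R, (1%:E <= p)%E ->
   class_dist p (scale_class hstar) (scale_class hbar)
     <= 7 * (K * S)%:R `^ exponent_inv p * gamma / sigma_min A
        * Num.min (linfnorm (segre hbar) `^ (K%:R^-1 - 1))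
                  (linfnorm (segre hstar) `^ (K%:R^-1 - 1))
        * (delta + eta)).
Proof.
have S_gt0 : (0 < S)%N by exact: leq_trans S_ge2.
have sigma_gt0 := sigma_min_gt0 A_neq0.
have net_dist :
    l2norm (mxentries (A (segre hstar - segre hbar))) <= delta + eta.
  rewrite linearB -!A_lift /=.
  have -> : network M hstar - network M hbar =
      (network M hstar - X) - (network M hbar - X).
    by rewrite opprB addrA subrK.
  by rewrite [leRHS]addrC; apply: le_trans (l2norm_mxB _ _) _; rewrite lerD.
have segre_dist :
    l2norm (segre hstar - segre hbar) <= gamma / sigma_min A * (delta + eta).
  have [T' AT'0 T'_le] :=
    tensor_kernel_approx A_neq0 (segre hstar - segre hbar).
  apply: (@le_trans _ _ (gamma * l2norm (segre hstar - segre hbar - T'))).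
    apply: (A_NSP Lstar Lbar) AT'0; first by exists hstar, hbar.
    exact: le_trans net_dist delta_eta_rho.
  rewrite -mulrA ler_wpM2l ?(ltW gamma_gt0) // mulrC ler_pdivlMr // mulrC.
  exact: le_trans T'_le net_dist.
split=> // hbar_star small p p1.
set E := gamma / _ * _ in segre_dist small.
(* The maximum is positive since [hbar] has no zero column, so being at most half of it is being
   strictly below it. *)
have E_lt : E < Num.max (linfnorm (segre hstar)) (linfnorm (segre hbar)).
  have max_gt0 : 0 < Num.max (linfnorm (segre hbar)) (linfnorm (segre hstar)).
    by rewrite lt_max linfnorm_segre_gt0.
  by rewrite maxC; apply: le_lt_trans small _; lra.
have linf_E : linfnorm (segre hstar - segre hbar) <= E.
  apply: le_trans segre_dist; apply: linfnorm_le => [|x].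
    exact: l2norm_ge0.
  exact: le_l2norm.
apply: le_trans (class_dist_segre_le S_gt0 K_ge1 p1 linf_E E_lt) _.
rewrite minC; set m := Num.min _ _; set c := _ `^ exponent_inv p.
(* Both sides are now multiples of the nonnegative [c * (E * m)], and [2 <= 7] concludes. *)
have -> : 7 * c * gamma / sigma_min A * m * (delta + eta) = 7 * (c * (E * m)).
  by rewrite /E; ring.
have -> : c * (2 * E * m) = 2 * (c * (E * m)) by ring.
rewrite ler_wpM2r ?ler_nat // !mulr_ge0 ?powR_ge0 // ?addr_ge0 //.
- exact: ltW.
- by rewrite invr_ge0 ltW.
- by rewrite /m le_min !powR_ge0.
Qed.
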